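(* Let $\hat\pi$ and $\pi$ be probability distributions on $\mathbb{R}^d$ and let $\varepsilon>0$. (1) If $W_1(\hat\pi,\pi)\le\varepsilon$ or $W_2(\hat\pi,\pi)\le\varepsilon$, then $$\|m_{\hat\pi}-m_\pi\|_2\le\varepsilon\qquad\text{and}\qquad \max_{1\le i\le d}|\mathrm{MAD}_{\hat\pi,i}-\mathrm{MAD}_{\pi,i}|\le 2\varepsilon.$$ (2) If $W_2(\hat\pi,\pi)\le\varepsilon$, then, with $S:=\sqrt{\min\{\|\Sigma_{\hat\pi}\|_2,\|\Sigma_\pi\|_2\}}$, $$\max_{1\le i\le d}|\sigma_{\hat\pi,i}-\sigma_{\pi,i}|\le\varepsilon\qquad\text{and}\qquad \|\Sigma_{\hat\pi}-\Sigma_\pi\|_2< 2\varepsilon(S+\varepsilon).$$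
   Context: For a probability distribution $\xi$ on $\mathbb{R}^d$ and $\vartheta\sim\xi$: $m_\xi=\mathbb{E}(\vartheta)$ is the mean; $\mathrm{MAD}_{\xi,i}=\mathbb{E}(|\vartheta_i-m_{\xi,i}|)$ is the mean absolute deviation of the $i$th component; $\Sigma_\xi=\mathbb{E}\{(\vartheta-m_\xi)(\vartheta-m_\xi)^\top\}$ is the covariance matrix; $\sigma_{\xi,i}=\Sigma_{\xi,ii}^{1/2}$ is the marginal standard deviation of the $i$th component. The distributions $\hat\pi$ and $\pi$ are understood to have the moments needed for these quantities to be defined (finite first moments in (1), finite second moments in (2)). For vectors $\|\cdot\|_2$ is the Euclidean norm; for matrices it is the spectral (operator) norm. For $p\ge1$, $W_p(\xi,\pi)=\inf_{\gamma}\{\int\|\theta-\theta'\|_2^p\,\gamma(d\theta,d\theta')\}^{1/p}$ is the $p$-Wasserstein distance, the infimum being over couplings $\gamma$ of $\xi$ and $\pi$, i.e. Borel measures on $\mathbb{R}^d\times\mathbb{R}^d$ with marginals $\xi$ and $\pi$. *)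

(* Defs.v *)
From HB Require Import structures.
From mathcomp Require Import all_boot all_order all_algebra.
From mathcomp Require Import all_classical all_reals all_analysis.
Import Order.TTheory GRing.Theory Num.Theory.
Import numFieldNormedType.Exports.

Set Implicit Arguments.
Unset Strict Implicit.
Unset Printing Implicit Defensive.

Local Open Scope classical_set_scope.
Local Open Scope ring_scope.

(* Matrices, in particular the column vectors ['cV[R]_d] standing for R^d,
   carry the Borel sigma-algebra. *)
HB.instance Definition _ (R : realType) (m n : nat) :=
  isMeasurable.Build (sigma_display (open : set (set 'M[R]_(m, n)))) 'M[R]_(m, n)
    (@sigma_algebra0 _ setT open) (@sigma_algebraC _ open)
    (@sigma_algebra_bigcup _ setT open).

(* The library norm [`|x|] on matrices is the sup norm of the entries. *)
Definition norm2 (R : realType) (d : nat) (x : 'cV[R]_d) : R :=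
  Num.sqrt (\sum_(i < d) x i 0 ^+ 2).

Definition spectral_norm (R : realType) (d : nat) (A : 'M[R]_d) : R :=
  sup [set norm2 (A *m x) | x in [set x : 'cV[R]_d | norm2 x <= 1]].

Definition finite_moment (R : realType) (d : nat) (p : R)
    (xi : probability 'cV[R]_d R) : Prop :=
  (\int[xi]_x (norm2 x `^ p)%:E < +oo)%E.

Definition mean (R : realType) (d : nat) (xi : probability 'cV[R]_d R) :
    'cV[R]_d :=
  \col_i fine 'E_xi[fun x => x i 0].

Definition mad (R : realType) (d : nat) (xi : probability 'cV[R]_d R)
    (i : 'I_d) : R :=
  fine 'E_xi[fun x => `|x i 0 - mean xi i 0|].

Definition cov_mx (R : realType) (d : nat) (xi : probability 'cV[R]_d R) :
    'M[R]_d :=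
  \matrix_(i, j) fine (covariance xi (fun x => x i 0) (fun x => x j 0)).

Definition std_dev (R : realType) (d : nat) (xi : probability 'cV[R]_d R)
    (i : 'I_d) : R :=
  Num.sqrt (cov_mx xi i i).

(* The product sigma-algebra on ['cV[R]_d * 'cV[R]_d] is the Borel one, since
   R^d is second countable. *)
Definition coupling (R : realType) (d : nat) (xi pi : probability 'cV[R]_d R)
    (gamma : probability ('cV[R]_d * 'cV[R]_d)%type R) : Prop :=
  forall A : set 'cV[R]_d, measurable A ->
    gamma (fst @^-1` A) = xi A /\ gamma (snd @^-1` A) = pi A.

Definition wasserstein (R : realType) (d : nat) (p : R)
    (xi pi : probability 'cV[R]_d R) : \bar R :=
  ereal_inf
    [set poweR (\int[gamma]_t (norm2 (t.1 - t.2) `^ p)%:E)%E (p^-1)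
      | gamma in [set gamma | coupling xi pi gamma]].

(* Main.v *)
(** The infimum over couplings need not be known to be attained: for every
    [b > eps] some coupling [gamma] of the two laws has transport cost at most
    [b], and all bounds but the last follow by letting [b] decrease to [eps].
    The mean and MAD bounds are Jensen and triangle inequalities for
    [t.1 - t.2] under [gamma], where [2 b z <= z^2 + b^2] reduces [W_2] to
    [W_1]. For a direction [v], the quadratic form [<v, Sigma v>] is the
    variance of [<v, x>]; Minkowski in [L^2(gamma)] and the fact that centering
    decreases second moments show that the two directional standard deviations
    differ by at most [eps |v|]. As [s^2 - t^2 = (s - t)(s + t)], the quadratic
    form of the difference of the covariances is at most
    [(2 eps S + eps^2) |v|^2], which bounds the spectral norm of this symmetric
    matrix by [2 eps S + eps^2]; strictness comes from [eps^2 < 2 eps^2]. *)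
Require Import Defs.
From mathcomp Require Import all_boot all_order all_algebra.
From mathcomp Require Import all_classical all_reals all_analysis measurable_realfun.
From mathcomp Require Import ring lra.
Import Order.TTheory GRing.Theory Num.Theory.
Import numFieldNormedType.Exports.
Local Open Scope ring_scope.

Set Implicit Arguments.
Unset Strict Implicit.

(** * Euclidean inner product and spectral norm *)

Definition dot {R : realType} {d : nat} (u v : 'cV[R]_d) : R :=
  \sum_(i < d) u i 0 * v i 0.

Section Euclidean.
Context {R : realType} {d : nat}.
Implicit Types (u v w : 'cV[R]_d) (A : 'M[R]_d).

Lemma dotC u v : dot u v = dot v u.
Proof. by apply: eq_bigr => i _; rewrite mulrC. Qed.

Lemma dotDl u v w : dot (u + v) w = dot u w + dot v w.
Proof. by rewrite -big_split; apply: eq_bigr => i _; rewrite mxE mulrDl. Qed.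

Lemma dotZl a u v : dot (a *: u) v = a * dot u v.
Proof. by rewrite mulr_sumr; apply: eq_bigr => i _; rewrite mxE mulrA. Qed.

Lemma dotBl u v w : dot (u - v) w = dot u w - dot v w.
Proof. by rewrite dotDl -scaleN1r dotZl mulN1r. Qed.

Lemma dotDr u v w : dot u (v + w) = dot u v + dot u w.
Proof. by rewrite ![dot u _]dotC dotDl. Qed.

Lemma dotBr u v w : dot u (v - w) = dot u v - dot u w.
Proof. by rewrite ![dot u _]dotC dotBl. Qed.

Lemma dotZr a u v : dot u (a *: v) = a * dot u v.
Proof. by rewrite ![dot u _]dotC dotZl. Qed.

Lemma dot_sym A u v : A^T = A -> dot u (A *m v) = dot (A *m u) v.
Proof.
move=> Asym; transitivity ((u^T *m (A *m v)) 0 0).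
  by rewrite mxE; apply: eq_bigr => i _; rewrite [u^T _ _]mxE.
rewrite mulmxA -{1}Asym -trmx_mul mxE.
by apply: eq_bigr => i _; rewrite [_^T _ _]mxE.
Qed.

Lemma norm2_ge0 u : 0 <= norm2 u. Proof. exact: sqrtr_ge0. Qed.

Lemma sqr_norm2 u : norm2 u ^+ 2 = dot u u.
Proof.
rewrite sqr_sqrtr; first by apply: eq_bigr => i _; rewrite expr2.
by apply: sumr_ge0 => i _; exact: sqr_ge0.
Qed.

Lemma norm2Z a u : norm2 (a *: u) = `|a| * norm2 u.
Proof.
apply/eqP; rewrite -(@eqrXn2 _ 2) ?mulr_ge0 ?norm2_ge0// exprMn !sqr_norm2.
by rewrite dotZl dotZr mulrA -expr2 real_normK ?num_real.
Qed.

Lemma norm2_0 : norm2 (0 : 'cV[R]_d) = 0.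
Proof. by rewrite -(scale0r 0) norm2Z normr0 mul0r. Qed.

Lemma norm2_eq0 u : norm2 u = 0 -> u = 0.
Proof.
move=> u0; have /eqP : dot u u = 0 by rewrite -sqr_norm2 u0 expr0n.
rewrite psumr_eq0 => [/allP h|i _]; last by rewrite -expr2 sqr_ge0.
apply/colP => i; rewrite mxE; apply/eqP.
by have := h i (mem_index_enum i); rewrite mulf_eq0 orbb.
Qed.

(** Cauchy-Schwarz: for nonzero vectors, expand the squared norm of [norm2 v *: u - norm2 u *: v]
    and divide by [norm2 u * norm2 v]. *)
Lemma dot_le u v : dot u v <= norm2 u * norm2 v.
Proof.
have [/norm2_eq0 -> | u0] := eqVneq (norm2 u) 0.
  by rewrite -(scale0r 0) dotZl mul0r mulr_ge0// norm2_ge0.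
have [/norm2_eq0 -> | v0] := eqVneq (norm2 v) 0.
  by rewrite -(scale0r 0) dotZr mul0r mulr_ge0// norm2_ge0.
have ab0 : 0 < norm2 u * norm2 v by rewrite mulr_gt0// lt0r norm2_ge0 andbT.
have := sqr_ge0 (norm2 (norm2 v *: u - norm2 u *: v)).
rewrite sqr_norm2 dotBl !dotBr !dotZl !dotZr -!sqr_norm2 [dot v u]dotC => h.
rewrite -(ler_pM2l ab0); nra.
Qed.

Lemma dot_abs_le u v : `|dot u v| <= norm2 u * norm2 v.
Proof.
rewrite ler_norml dot_le andbT lerNl -mulN1r -dotZl.
by apply: le_trans (dot_le _ _) _; rewrite norm2Z normrN1 mul1r.
Qed.

(** Coordinates are projections along basis vectors, so results on [dot v] specialize to single
    components. *)
Lemma dot_delta (i : 'I_d) u : dot (delta_mx i 0) u = u i 0.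
Proof.
rewrite /dot (bigD1 i)//= mxE !eqxx mul1r big1 ?addr0// => j ji.
by rewrite mxE (negbTE ji) mul0r.
Qed.

Lemma norm2_delta (i : 'I_d) : norm2 (delta_mx i 0 : 'cV[R]_d) = 1.
Proof.
apply/eqP; rewrite -(@eqrXn2 _ 2) ?norm2_ge0//.
by rewrite sqr_norm2 dot_delta mxE !eqxx expr1n.
Qed.

Lemma coord_le_norm2 u (i : 'I_d) : `|u i 0| <= norm2 u.
Proof. by rewrite -dot_delta (le_trans (dot_abs_le _ _))// norm2_delta mul1r. Qed.

(** A [sup] bounds its set only once the set is known to be bounded above. Cauchy-Schwarz on each
    row gives the Frobenius norm as a bound. *)
Lemma norm2_mulmx_bounded A :
  has_ubound [set norm2 (A *m x) | x in [set x : 'cV[R]_d | norm2 x <= 1]]%classic.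
Proof.
pose M := \sum_(i < d) norm2 (row i A)^T ^+ 2.
have M0 : 0 <= M by apply: sumr_ge0 => i _; exact: sqr_ge0.
exists (Num.sqrt M) => _ [x /= x1 <-].
apply: ler_wsqrtr; apply: ler_sum => i _.
have -> : (A *m x) i 0 = dot (row i A)^T x.
  by rewrite mxE; apply: eq_bigr => j _; rewrite !mxE.
rewrite -real_normK ?num_real// ler_sqr ?nnegrE ?norm2_ge0//.
apply: le_trans (dot_abs_le _ _) _.
by rewrite ler_piMr// norm2_ge0.
Qed.

Lemma norm2_mulmx_le_spectral A u : norm2 (A *m u) <= spectral_norm A * norm2 u.
Proof.
have [/norm2_eq0 -> | u0] := eqVneq (norm2 u) 0.
  by rewrite mulmx0 norm2_0 mulr0.
have un : 0 < norm2 u by rewrite lt0r u0 norm2_ge0.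
rewrite -ler_pdivrMr// mulrC.
have -> : (norm2 u)^-1 * norm2 (A *m u) = norm2 (A *m ((norm2 u)^-1 *: u)).
  by rewrite -scalemxAr norm2Z gtr0_norm ?invr_gt0.
apply: ub_le_sup; first exact: norm2_mulmx_bounded.
exists ((norm2 u)^-1 *: u) => //=.
by rewrite norm2Z gtr0_norm ?invr_gt0// mulVf.
Qed.

Lemma quad_le_spectral A u : dot u (A *m u) <= spectral_norm A * norm2 u ^+ 2.
Proof.
apply: le_trans (dot_le _ _) _; rewrite mulrC expr2 mulrA.
by rewrite ler_wpM2r ?norm2_ge0// norm2_mulmx_le_spectral.
Qed.

Lemma spectral_norm_ge0 A : 0 <= spectral_norm A.
Proof.
apply: ub_le_sup; first exact: norm2_mulmx_bounded.
by exists 0 => /=; rewrite ?mulmx0 norm2_0.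
Qed.

(* Polarization: [4 <tAv, Av> = q(tAv + v) - q(tAv - v)] for [q w = <w, Aw>],
   bounded through the parallelogram law, with [t = |v| / |Av|]. *)
Lemma spectral_norm_le A c : A^T = A -> 0 <= c ->
  (forall u, `|dot u (A *m u)| <= c * norm2 u ^+ 2) -> spectral_norm A <= c.
Proof.
move=> Asym c0 Ac.
have Ale v : norm2 (A *m v) <= c * norm2 v.
  have [/norm2_eq0 -> | v0] := eqVneq (norm2 v) 0.
    by rewrite mulmx0 norm2_0 mulr0.
  have vn : 0 < norm2 v by rewrite lt0r v0 norm2_ge0.
  have [-> | w0] := eqVneq (norm2 (A *m v)) 0.
    by rewrite mulr_ge0// norm2_ge0.
  have wn : 0 < norm2 (A *m v) by rewrite lt0r w0 norm2_ge0.
  pose t := norm2 v / norm2 (A *m v).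
  have tw : t * norm2 (A *m v) = norm2 v by rewrite divfK.
  pose u := t *: (A *m v).
  have nu : norm2 u = norm2 v.
    by rewrite norm2Z gtr0_norm ?divr_gt0.
  have uv : dot u (A *m v) = norm2 v * norm2 (A *m v).
    by rewrite dotZl -sqr_norm2 expr2 mulrA tw.
  have /ler_normlP[_ h1] := Ac (u + v); have /ler_normlP[h2 _] := Ac (u - v).
  have vu : dot v (A *m u) = norm2 v * norm2 (A *m v).
    by rewrite dot_sym// dotC.
  rewrite sqr_norm2 mulmxDr !dotDl !dotDr uv vu -2!sqr_norm2 nu [dot v u]dotC in h1.
  rewrite sqr_norm2 mulmxBr !dotBl !dotBr uv vu -2!sqr_norm2 nu [dot v u]dotC in h2.
  rewrite -(ler_pM2l vn); nra.
apply: ge_sup; first by exists (norm2 (A *m 0)), 0; rewrite //= norm2_0.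
move=> _ [x /= x1 <-]; apply: le_trans (Ale x) _.
by rewrite ler_piMr.
Qed.

End Euclidean.

(** * Real-valued integrals under a probability measure *)

Local Notation integrable_fun P X := (P.-integrable setT (EFin \o X)).

Section RealIntegral.
Context {disp : measure_display} {T : measurableType disp} {R : realType}.
Variable P : probability T R.
Implicit Types (X Y Z : T -> R) (a c : R).

Lemma integrable_funD X Y : integrable_fun P X -> integrable_fun P Y ->
  integrable_fun P (fun t => X t + Y t).
Proof.
by move=> iX iY; apply: eq_integrable (integrableD measurableT iX iY) => // t _.
Qed.

Lemma integrable_funZ a X : integrable_fun P X ->
  integrable_fun P (fun t => a * X t).
Proof.
by move=> iX; apply: eq_integrable (integrableZl measurableT a iX) => // t _.
Qed.

Lemma integrable_cst a : integrable_fun P (fun=> a).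
Proof. exact: finite_measure_integrable_cst. Qed.

Lemma integrable_funB X Y : integrable_fun P X -> integrable_fun P Y ->
  integrable_fun P (fun t => X t - Y t).
Proof.
by move=> iX iY; apply: eq_integrable (integrableB measurableT iX iY) => // t _.
Qed.

Lemma integrable_fun_sum (I : Type) (s : seq I) (X : I -> T -> R) :
  (forall i, integrable_fun P (X i)) ->
  integrable_fun P (fun t => \sum_(i <- s) X i t).
Proof.
move=> iX; elim: s => [|i s ih].
  rewrite (_ : (fun _ => _) = fun=> 0); first exact: integrable_cst.
  by apply/funext => t; rewrite big_nil.
rewrite (_ : (fun _ => _) = fun t => X i t + \sum_(j <- s) X j t).
  exact: integrable_funD.
by apply/funext => t; rewrite big_cons.
Qed.

Lemma Rintegral_sum (I : Type) (s : seq I) (X : I -> T -> R) :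
  (forall i, integrable_fun P (X i)) ->
  \int[P]_t (\sum_(i <- s) X i t) = \sum_(i <- s) \int[P]_t X i t.
Proof.
move=> iX; elim: s => [|i s ih].
  under eq_Rintegral do rewrite big_nil.
  by rewrite big_nil Rintegral_cst// mul0r.
under eq_Rintegral do rewrite big_cons.
rewrite big_cons RintegralD ?ih//; exact: integrable_fun_sum.
Qed.

Lemma Rintegral_prob_cst a : \int[P]_(_ in setT) a = a.
Proof. by rewrite Rintegral_cst//= probability_setT mulr1. Qed.

Lemma integrable_dominated X Y : measurable_fun setT X ->
  (forall t, `|X t| <= Y t) -> integrable_fun P Y -> integrable_fun P X.
Proof.
move=> mX XY; apply: le_integrable => //; first exact/measurable_EFinP.
by move=> t _; rewrite /= lee_fin (le_trans (XY t))// ler_norm.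
Qed.

Lemma integrable_measurable X : integrable_fun P X -> measurable_fun setT X.
Proof. by move=> /(measurable_int P) /measurable_EFinP. Qed.

Lemma integrable_fun_norm X : integrable_fun P X ->
  integrable_fun P (fun t => `|X t|).
Proof.
move=> iX; have := integrable_abse iX.
by apply: eq_integrable.
Qed.

(** Domination by [1 + X ^+ 2]; this is how second moments yield first moments. *)
Lemma integrable_of_sqr X : measurable_fun setT X ->
  integrable_fun P (fun t => X t ^+ 2) -> integrable_fun P X.
Proof.
move=> mX iX2; apply: (@integrable_dominated _ (fun t => 1 + X t ^+ 2)) => //.
  move=> t; rewrite -[X t ^+ 2]real_normK ?num_real//.
  have := sqr_ge0 (`|X t| - 1); have := normr_ge0 (X t); nra.
by apply: integrable_funD => //; exact: integrable_cst.
Qed.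

Lemma integrable_mul_of_sqr X Y : measurable_fun setT X -> measurable_fun setT Y ->
  integrable_fun P (fun t => X t ^+ 2) -> integrable_fun P (fun t => Y t ^+ 2) ->
  integrable_fun P (fun t => X t * Y t).
Proof.
move=> mX mY iX iY.
apply: (@integrable_dominated _ (fun t => X t ^+ 2 + Y t ^+ 2)).
- exact: measurable_funM.
- move=> t; rewrite ler_norml; apply/andP; split;
  have := sqr_ge0 (X t + Y t); have := sqr_ge0 (X t - Y t); nra.
- exact: integrable_funD.
Qed.

Lemma integrable_sqrB X Y : measurable_fun setT X -> measurable_fun setT Y ->
  integrable_fun P (fun t => X t ^+ 2) -> integrable_fun P (fun t => Y t ^+ 2) ->
  integrable_fun P (fun t => (X t - Y t) ^+ 2).
Proof.
move=> mX mY iX iY.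
apply: (@integrable_dominated _ (fun t => 2 * X t ^+ 2 + 2 * Y t ^+ 2)).
- by apply: measurable_funX; exact: measurable_funB.
- move=> t; rewrite ger0_norm ?sqr_ge0//.
  have := sqr_ge0 (X t + Y t); nra.
- by apply: integrable_funD; exact: integrable_funZ.
Qed.

(* Integrate [2 c X <= X^2 + c^2]. *)
Lemma Rintegral_le_of_sqr X c : 0 < c -> integrable_fun P X ->
  integrable_fun P (fun t => X t ^+ 2) ->
  \int[P]_t X t ^+ 2 <= c ^+ 2 -> \int[P]_t X t <= c.
Proof.
move=> c0 iX iX2 Xc.
have : \int[P]_t (2 * c * X t) <= \int[P]_t (X t ^+ 2 + c ^+ 2).
  apply: le_Rintegral => //; first exact: integrable_funZ.
    by apply: integrable_funD => //; exact: integrable_cst.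
  by move=> t _; have := sqr_ge0 (X t - c); nra.
rewrite RintegralZl// RintegralD//; last exact: integrable_cst.
rewrite Rintegral_prob_cst => h; nra.
Qed.

(* With [b > |Y|_2], integrate [b c X^2 <= (b + c) c Y^2 + (b + c) b (X - Y)^2]
   and let [b] decrease to [|Y|_2]. *)
Lemma minkowski_sqr X Y c : 0 < c ->
  measurable_fun setT X -> measurable_fun setT Y ->
  integrable_fun P (fun t => X t ^+ 2) -> integrable_fun P (fun t => Y t ^+ 2) ->
  \int[P]_t (X t - Y t) ^+ 2 <= c ^+ 2 ->
  Num.sqrt (\int[P]_t X t ^+ 2) <= Num.sqrt (\int[P]_t Y t ^+ 2) + c.
Proof.
move=> c0 mX mY iX iY XYc.
have iXY := integrable_sqrB mX mY iX iY.
apply/ler_addgt0Pr => e e0.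
set s := Num.sqrt (\int[P]_t Y t ^+ 2).
have s0 : 0 <= s by exact: sqrtr_ge0.
(* The slack [e] keeps [b] positive even when [s] vanishes, so that the factor [b * c] can be
   cancelled. *)
pose b := s + e; have b0 : 0 < b by rewrite /b; lra.
have ssq : s ^+ 2 = \int[P]_t Y t ^+ 2.
  by rewrite sqr_sqrtr// Rintegral_ge0// => t _; exact: sqr_ge0.
suff h : b * c * \int[P]_t X t ^+ 2 <= b * c * (b + c) ^+ 2.
  rewrite ler_pM2l ?mulr_gt0// in h.
  suff -> : s + c + e = Num.sqrt ((b + c) ^+ 2) by exact: ler_wsqrtr.
  rewrite sqrtr_sqr ger0_norm; first by rewrite /b; ring.
  by rewrite ltW// addr_gt0.
have : \int[P]_t (b * c * X t ^+ 2) <=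
    \int[P]_t ((b + c) * c * Y t ^+ 2 + (b + c) * b * (X t - Y t) ^+ 2).
  apply: le_Rintegral => //; first exact: integrable_funZ.
    by apply: integrable_funD; exact: integrable_funZ.
  (* The two integrands differ by exactly this square. *)
  move=> t _; have := sqr_ge0 (c * Y t - b * (X t - Y t)); nra.
rewrite RintegralD//; [|exact: integrable_funZ..].
rewrite !RintegralZl// -ssq => /le_trans; apply.
have bs : s ^+ 2 <= b ^+ 2 by rewrite /b; nra.
have h1 : (b + c) * c * s ^+ 2 <= (b + c) * c * b ^+ 2.
  by rewrite ler_wpM2l// mulr_ge0 ?addr_ge0// ltW.
have h2 : (b + c) * b * \int[P]_t (X t - Y t) ^+ 2 <= (b + c) * b * c ^+ 2.
  by rewrite ler_wpM2l// mulr_ge0 ?addr_ge0// ltW.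
apply: le_trans (lerD h1 h2) _.
by rewrite le_eqVlt; apply/orP; left; apply/eqP; ring.
Qed.

(** Expanding the square, the left side is the second moment minus the square of the mean. *)
Lemma Rintegral_sqr_centered X : integrable_fun P X ->
  integrable_fun P (fun t => X t ^+ 2) ->
  \int[P]_t (X t - \int[P]_s X s) ^+ 2 <= \int[P]_t X t ^+ 2.
Proof.
move=> iX iX2; set m := \int[P]_s X s.
have i1 : integrable_fun P (fun t => X t ^+ 2 - 2 * m * X t).
  by apply: integrable_funB => //; exact: integrable_funZ.
rewrite (_ : \int[P]_t _ = \int[P]_t (X t ^+ 2 - 2 * m * X t + m ^+ 2)).
  rewrite RintegralD//; last exact: integrable_cst.
  rewrite RintegralB//; last exact: integrable_funZ.
  rewrite RintegralZl// Rintegral_prob_cst -/m; have := sqr_ge0 m; nra.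
by apply: eq_Rintegral => t _; ring.
Qed.

End RealIntegral.

(** * Change of variables along a map that carries [P] to [Q] *)

Section Transfer.
Context {d1 d2 : measure_display} {T : measurableType d1} {U : measurableType d2}.
Context {R : realType} (P : probability T R) (Q : probability U R) (phi : T -> U).
Hypothesis mphi : measurable_fun setT phi.
Hypothesis imagePQ : forall A, measurable A -> P (phi @^-1` A)%classic = Q A.

(** By [imagePQ], [Q] agrees with the pushforward of [P] on measurable sets; the change of variables
    for nonnegative functions then moves the integral of the absolute value. *)
Lemma integrable_transfer (f : U -> R) :
  integrable_fun Q f -> integrable_fun P (f \o phi).
Proof.
move=> iQ; have mf := integrable_measurable iQ.
apply/integrableP; split.
  by apply/measurable_EFinP; exact: measurableT_comp.
case/integrableP: iQ => _; apply: le_lt_trans.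
rewrite -(@eq_measure_integral _ _ _ setT _ (pushforward P phi)); last first.
  by move=> A mA _; exact: imagePQ.
rewrite ge0_integral_pushforward//.
by apply: measurableT_comp => //; exact/measurable_EFinP.
Qed.

(** The signed change of variables asks for integrability of the composite, which
    [integrable_transfer] supplies. *)
Lemma Rintegral_transfer (f : U -> R) :
  integrable_fun Q f -> \int[P]_t f (phi t) = \int[Q]_u f u.
Proof.
move=> iQ; have mf := integrable_measurable iQ.
congr fine; rewrite -[RHS](@eq_measure_integral _ _ _ setT _ (pushforward P phi)).
  rewrite integral_pushforward//; first exact/measurable_EFinP.
  exact: integrable_transfer.
by move=> A mA _; exact: imagePQ.
Qed.

End Transfer.

(** * Random vectors: projections, norms and expectations *)

Section RandomVector.
Context {disp : measure_display} {T : measurableType disp} {R : realType} {d : nat}.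
Variable X : T -> 'cV[R]_d.
Hypothesis mX : forall i, measurable_fun setT (fun t => X t i 0).

Lemma measurable_dot v : measurable_fun setT (fun t => dot v (X t)).
Proof. by apply: measurable_sum => i; exact: measurable_funM. Qed.

Lemma measurable_norm2 : measurable_fun setT (fun t => norm2 (X t)).
Proof.
apply: (measurableT_comp (continuous_measurable_fun (@sqrt_continuous R))).
by apply: measurable_sum => i; exact: measurable_funX.
Qed.

Variable P : probability T R.

Lemma integrable_dot v : integrable_fun P (fun t => norm2 (X t)) ->
  integrable_fun P (fun t => dot v (X t)).
Proof.
move=> iX.
apply: (@integrable_dominated _ _ _ _ _ (fun t => norm2 v * norm2 (X t))).
- exact: measurable_dot.
- by move=> t; exact: dot_abs_le.
- exact: integrable_funZ.
Qed.

Lemma integrable_sqr_dot v : integrable_fun P (fun t => norm2 (X t) ^+ 2) ->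
  integrable_fun P (fun t => dot v (X t) ^+ 2).
Proof.
move=> iX.
apply: (@integrable_dominated _ _ _ _ _
  (fun t => norm2 v ^+ 2 * norm2 (X t) ^+ 2)).
- by apply: measurable_funX; exact: measurable_dot.
- move=> t; rewrite normrX -exprMn ler_sqr ?nnegrE ?mulr_ge0 ?norm2_ge0//.
  exact: dot_abs_le.
- exact: integrable_funZ.
Qed.

Lemma integrable_coord i : integrable_fun P (fun t => norm2 (X t)) ->
  integrable_fun P (fun t => X t i 0).
Proof.
move=> /(integrable_dot (delta_mx i 0)); apply: eq_integrable => // t _ /=.
by rewrite dot_delta.
Qed.

Lemma dot_Rintegral v : integrable_fun P (fun t => norm2 (X t)) ->
  dot v (\col_i \int[P]_t X t i 0) = \int[P]_t dot v (X t).
Proof.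
move=> iX; rewrite Rintegral_sum; last first.
  by move=> i; apply: integrable_funZ; exact: integrable_coord.
apply: eq_bigr => i _; rewrite mxE RintegralZl//; exact: integrable_coord.
Qed.

(** Jensen for the norm. With [m] the expectation, [norm2 m ^+ 2] is the integral of [dot m (X t)],
    at most [norm2 m] times the integral of [norm2 (X t)]; divide by [norm2 m]. *)
Lemma norm2_Rintegral_le : integrable_fun P (fun t => norm2 (X t)) ->
  norm2 (\col_i \int[P]_t X t i 0) <= \int[P]_t norm2 (X t).
Proof.
move=> iX; set m := (\col_i _).
have [->|m0] := eqVneq (norm2 m) 0.
  by apply: Rintegral_ge0 => t _; exact: norm2_ge0.
have mp : 0 < norm2 m by rewrite lt0r m0 norm2_ge0.
rewrite -(ler_pM2l mp) -expr2 sqr_norm2 dot_Rintegral// -RintegralZl//.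
apply: le_Rintegral => //; [exact: integrable_dot|exact: integrable_funZ|].
by move=> t _; exact: dot_le.
Qed.

End RandomVector.

(** * Moments of a law on R^d and its directional variances *)

Section Moments.
Context {R : realType} {d : nat}.
Implicit Types (xi pi : probability 'cV[R]_d R)
  (gamma : probability ('cV[R]_d * 'cV[R]_d)%type R).

(** Open intervals generate the Borel sets of the line, and their preimages under a continuous
    coordinate are open. *)
Lemma measurable_coord (i : 'I_d) : measurable_fun setT (fun x : 'cV[R]_d => x i 0).
Proof.
apply: (measurability _ (RGenOpens.measurableE R)) => _ [_ [a [b ->] <-]].
rewrite setTI; apply: sub_sigma_algebra.
have /continuousP := @coord_continuous R d 1 i 0.
by apply; exact: interval_open.
Qed.

Lemma measurable_norm2_id : measurable_fun setT (fun x : 'cV[R]_d => norm2 x).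
Proof. by apply: (@measurable_norm2 _ _ _ _ id); exact: measurable_coord. Qed.

(** The real power with exponent [n%:R] becomes a natural power; the integrand being nonnegative, a
    finite integral amounts to integrability. *)
Lemma finite_momentP n xi :
  finite_moment n%:R xi <-> integrable_fun xi (fun x => norm2 x ^+ n).
Proof.
have E : (\int[xi]_x (norm2 x `^ n%:R)%:E = \int[xi]_x `|(norm2 x ^+ n)%:E|)%E.
  apply: eq_integral => x _ /=.
  by rewrite powR_mulrn ?norm2_ge0// ger0_norm ?exprn_ge0 ?norm2_ge0.
split=> [xin|/integrableP[_]]; last by rewrite -E.
apply/integrableP; split; last by rewrite -E.
by apply/measurable_EFinP; apply: measurable_funX; exact: measurable_norm2_id.
Qed.

Lemma finite_moment1_integrable xi :
  finite_moment 1 xi -> integrable_fun xi (fun x => norm2 x).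
Proof. exact: (finite_momentP 1 xi).1. Qed.

Lemma finite_moment2_1 xi : finite_moment 2 xi -> finite_moment 1 xi.
Proof.
move=> /(finite_momentP 2) i2; apply/(finite_momentP 1).
exact: integrable_of_sqr measurable_norm2_id i2.
Qed.

Lemma meanE xi : mean xi = \col_i \int[xi]_x x i 0.
Proof. by apply/colP => i; rewrite !mxE unlock. Qed.

Lemma madE xi i : mad xi i = \int[xi]_x `|x i 0 - \int[xi]_y y i 0|.
Proof. by rewrite /mad meanE unlock; under eq_fun do rewrite mxE. Qed.

Lemma covE xi i j : cov_mx xi i j =
  \int[xi]_x ((x i 0 - mean xi i 0) * (x j 0 - mean xi j 0)).
Proof. by rewrite mxE !unlock meanE !mxE. Qed.

Lemma cov_mx_sym xi : (cov_mx xi)^T = cov_mx xi.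
Proof. by apply/matrixP => i j; rewrite mxE [LHS]mxE [RHS]mxE covarianceC. Qed.

Definition dir_var xi (v : 'cV[R]_d) : R :=
  \int[xi]_x (dot v x - \int[xi]_y dot v y) ^+ 2.

Lemma integrable_sqr_centered xi v : finite_moment 2 xi ->
  integrable_fun xi (fun x => (dot v x - \int[xi]_y dot v y) ^+ 2).
Proof.
move=> /(finite_momentP 2) i2.
apply: integrable_sqrB.
- by apply: (@measurable_dot _ _ _ _ id); exact: measurable_coord.
- by [].
- by apply: (@integrable_sqr_dot _ _ _ _ id) => //; exact: measurable_coord.
- exact: integrable_cst.
Qed.

(** The squared centered projection is a double sum of products of centered coordinates [Z i]; these
    products are integrable, so the sums leave the integral. *)
Lemma quad_cov xi v : finite_moment 2 xi ->
  dot v (cov_mx xi *m v) = dir_var xi v.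
Proof.
move=> xi2; have xi1 := finite_moment1_integrable (finite_moment2_1 xi2).
pose Z i (x : 'cV[R]_d) := x i 0 - mean xi i 0.
have Zsq i : integrable_fun xi (fun x => Z i x ^+ 2).
  (* A centered coordinate is the centered projection along a basis vector. *)
  have := integrable_sqr_centered (delta_mx i 0) xi2.
  under eq_Rintegral do rewrite dot_delta.
  apply: eq_integrable => // x _ /=.
  by rewrite dot_delta /Z meanE mxE.
have mZ i : measurable_fun setT (Z i).
  by apply: measurable_funB => //; exact: measurable_coord.
have iZ i j : integrable_fun xi (fun x => Z i x * Z j x).
  exact: integrable_mul_of_sqr.
have E x : (dot v x - \int[xi]_y dot v y) ^+ 2 =
    \sum_i \sum_j v i 0 * v j 0 * (Z i x * Z j x).
  rewrite -(@dot_Rintegral _ _ _ _ id)//; last exact: measurable_coord.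
  rewrite -meanE -dotBr expr2 {1}/dot mulr_suml; apply: eq_bigr => i _.
  rewrite mulr_sumr; apply: eq_bigr => j _.
  have ZE k : (x - mean xi) k 0 = Z k x by rewrite mxE [X in _ + X]mxE.
  by rewrite !ZE; ring.
rewrite /dir_var; under eq_Rintegral do rewrite E.
rewrite Rintegral_sum; last first.
  by move=> i; apply: integrable_fun_sum => j; exact: integrable_funZ.
apply: eq_bigr => i _.
rewrite Rintegral_sum; last by move=> j; exact: integrable_funZ.
rewrite mxE mulr_sumr; apply: eq_bigr => j _.
by rewrite RintegralZl// covE; ring.
Qed.

Lemma dir_var_ge0 xi v : 0 <= dir_var xi v.
Proof. by apply: Rintegral_ge0 => x _; exact: sqr_ge0. Qed.

(** Reduces the componentwise bound to the directional one. *)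
Lemma std_devE xi i : finite_moment 2 xi ->
  std_dev xi i = Num.sqrt (dir_var xi (delta_mx i 0)).
Proof.
move=> xi2; by rewrite /std_dev -quad_cov// dot_delta -colE [col _ _ _ _]mxE.
Qed.

End Moments.

(** * Comparison of two laws through a fixed coupling *)

Section Coupling.
Context {R : realType} {d : nat} (xi pi : probability 'cV[R]_d R).
Variable gamma : probability ('cV[R]_d * 'cV[R]_d)%type R.
Hypothesis xipi : coupling xi pi gamma.

Lemma integrable_fst f : integrable_fun xi f ->
  integrable_fun gamma (fun t => f t.1).
Proof. by apply: integrable_transfer => // A /xipi[]. Qed.

Lemma integrable_snd f : integrable_fun pi f ->
  integrable_fun gamma (fun t => f t.2).
Proof. by apply: integrable_transfer => // A /xipi[]. Qed.

Lemma Rintegral_fst f : integrable_fun xi f ->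
  \int[gamma]_t f t.1 = \int[xi]_x f x.
Proof. by apply: (Rintegral_transfer (phi := fst)) => // A /xipi[]. Qed.

Lemma Rintegral_snd f : integrable_fun pi f ->
  \int[gamma]_t f t.2 = \int[pi]_x f x.
Proof. by apply: (Rintegral_transfer (phi := snd)) => // A /xipi[]. Qed.

(** Coordinatewise measurability is all that the lemmas on random vectors ask of [t.1 - t.2]. *)
Lemma measurable_gap i : measurable_fun setT
  (fun t : ('cV[R]_d * 'cV[R]_d)%type => (t.1 - t.2) i 0).
Proof.
rewrite (_ : (fun _ => _) =
    fun t : ('cV[R]_d * 'cV[R]_d)%type => t.1 i 0 - t.2 i 0); last first.
  by apply/funext => t; rewrite !mxE.
by apply: measurable_funB; apply: (measurableT_comp (measurable_coord i)).
Qed.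

(** The marginals turn the difference of means into the expectation of the gap under [gamma], to
    which Jensen applies. *)
Lemma mean_coupling_le : finite_moment 1 xi -> finite_moment 1 pi ->
  integrable_fun gamma (fun t => norm2 (t.1 - t.2)) ->
  norm2 (mean xi - mean pi) <= \int[gamma]_t norm2 (t.1 - t.2).
Proof.
move=> /finite_moment1_integrable ixi /finite_moment1_integrable ipi iD.
have ci i : integrable_fun xi (fun x : 'cV[R]_d => x i 0).
  by apply: (@integrable_coord _ _ _ _ id) => //; exact: measurable_coord.
have cj i : integrable_fun pi (fun x : 'cV[R]_d => x i 0).
  by apply: (@integrable_coord _ _ _ _ id) => //; exact: measurable_coord.
rewrite (_ : _ - _ = \col_i \int[gamma]_t (t.1 - t.2) i 0).
  exact: (norm2_Rintegral_le measurable_gap).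
apply/colP => i; rewrite !meanE !mxE.
rewrite -(Rintegral_fst (ci i)) -(Rintegral_snd (cj i)) -RintegralB//.
- by apply: eq_Rintegral => t _; rewrite !mxE.
- exact: (integrable_fst (ci i)).
- exact: (integrable_snd (cj i)).
Qed.

(** The factor 2 counts the transport cost twice: once for moving the point, once for moving the
    mean, whose shift is controlled by [mean_coupling_le]. *)
Lemma mad_coupling_le i : finite_moment 1 xi -> finite_moment 1 pi ->
  integrable_fun gamma (fun t => norm2 (t.1 - t.2)) ->
  `|mad xi i - mad pi i| <= 2 * \int[gamma]_t norm2 (t.1 - t.2).
Proof.
move=> mxi mpi iD.
have ixi := finite_moment1_integrable mxi; have ipi := finite_moment1_integrable mpi.
have ci : integrable_fun xi (fun x : 'cV[R]_d => `|x i 0 - mean xi i 0|).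
  apply: integrable_fun_norm; apply: integrable_funB; last exact: integrable_cst.
  by apply: (@integrable_coord _ _ _ _ id) => //; exact: measurable_coord.
have cj : integrable_fun pi (fun x : 'cV[R]_d => `|x i 0 - mean pi i 0|).
  apply: integrable_fun_norm; apply: integrable_funB; last exact: integrable_cst.
  by apply: (@integrable_coord _ _ _ _ id) => //; exact: measurable_coord.
have -> : mad xi i = \int[xi]_x `|x i 0 - mean xi i 0|.
  by rewrite madE meanE mxE.
have -> : mad pi i = \int[pi]_x `|x i 0 - mean pi i 0|.
  by rewrite madE meanE mxE.
rewrite -(Rintegral_fst ci) -(Rintegral_snd cj) -RintegralB//; last 2 first.
- exact: (integrable_fst ci).
- exact: (integrable_snd cj).
have iB : integrable_fun gamma
    (fun t : ('cV[R]_d * 'cV[R]_d)%type =>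
      `|t.1 i 0 - mean xi i 0| - `|t.2 i 0 - mean pi i 0|).
  by apply: integrable_funB; [exact: (integrable_fst ci)|exact: (integrable_snd cj)].
apply: le_trans (le_normr_Rintegral _ iB) _ => //.
have mean_le := mean_coupling_le mxi mpi iD.
set I := (X in 2 * X).
apply: (@le_trans _ _ (\int[gamma]_t (norm2 (t.1 - t.2) + I))); last first.
  rewrite RintegralD//; last exact: integrable_cst.
  by rewrite Rintegral_prob_cst -/I; lra.
apply: le_Rintegral => //.
- exact: integrable_fun_norm.
- by apply: integrable_funD => //; exact: integrable_cst.
move=> t _; apply: le_trans (ler_dist_dist _ _) _.
have := coord_le_norm2 (t.1 - t.2) i.
have := coord_le_norm2 (mean xi - mean pi) i.
have coordB (a b : 'cV[R]_d) : (a - b) i 0 = a i 0 - b i 0 by rewrite !mxE.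
rewrite !coordB => h1 h2.
rewrite (_ : _ - _ = (t.1 i 0 - t.2 i 0) - (mean xi i 0 - mean pi i 0)); last ring.
apply: le_trans (ler_normB _ _) _; apply: lerD => //.
exact: le_trans h1 mean_le.
Qed.

(** Minkowski under [gamma] for the centered projections [X] and [Y] of the two marginals, in both
    orders to reach the absolute value. *)
Lemma dir_std_coupling_le v c : 0 < c ->
  finite_moment 2 xi -> finite_moment 2 pi ->
  integrable_fun gamma (fun t => norm2 (t.1 - t.2) ^+ 2) ->
  \int[gamma]_t norm2 (t.1 - t.2) ^+ 2 <= c ^+ 2 ->
  `|Num.sqrt (dir_var xi v) - Num.sqrt (dir_var pi v)| <= c * norm2 v.
Proof.
move=> c0 mxi mpi iD Dc.
(* The zero direction is set apart because [minkowski_sqr] wants a positive constant, here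
   [c * norm2 v]. *)
have [/norm2_eq0 ->|v0] := eqVneq (norm2 v) 0.
  rewrite norm2_0 mulr0 (_ : dir_var xi 0 = dir_var pi 0) ?subrr ?normr0//.
  by rewrite -!quad_cov// -(scale0r 0) !dotZl !mul0r.
have vp : 0 < norm2 v by rewrite lt0r v0 norm2_ge0.
have ixi := finite_moment1_integrable (finite_moment2_1 mxi).
have ipi := finite_moment1_integrable (finite_moment2_1 mpi).
have ci : integrable_fun xi (dot v).
  by apply: (@integrable_dot _ _ _ _ id) => //; exact: measurable_coord.
have cj : integrable_fun pi (dot v).
  by apply: (@integrable_dot _ _ _ _ id) => //; exact: measurable_coord.
have ci2 := integrable_sqr_centered v mxi.
have cj2 := integrable_sqr_centered v mpi.
pose X (t : ('cV[R]_d * 'cV[R]_d)%type) := dot v t.1 - \int[xi]_y dot v y.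
pose Y (t : ('cV[R]_d * 'cV[R]_d)%type) := dot v t.2 - \int[pi]_y dot v y.
have mX : measurable_fun setT X.
  apply: (@integrable_measurable _ _ _ gamma).
  by apply: integrable_funB (integrable_cst _ _); exact: (integrable_fst ci).
have mY : measurable_fun setT Y.
  apply: (@integrable_measurable _ _ _ gamma).
  by apply: integrable_funB (integrable_cst _ _); exact: (integrable_snd cj).
have iX : integrable_fun gamma (fun t => X t ^+ 2) := integrable_fst ci2.
have iY : integrable_fun gamma (fun t => Y t ^+ 2) := integrable_snd cj2.
rewrite /dir_var -(Rintegral_fst ci2) -(Rintegral_snd cj2).
rewrite -/(X _) -/(Y _).
have cv : 0 < c * norm2 v by rewrite mulr_gt0.
have iG : integrable_fun gamma (fun t => dot v (t.1 - t.2)).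
  apply: integrable_dot; first exact: measurable_gap.
  apply: integrable_of_sqr => //; exact: measurable_norm2 measurable_gap.
have iG2 : integrable_fun gamma (fun t => dot v (t.1 - t.2) ^+ 2).
  by apply: integrable_sqr_dot => //; exact: measurable_gap.
have XY : \int[gamma]_t (X t - Y t) ^+ 2 <= (c * norm2 v) ^+ 2.
  (* [X - Y] is the projected gap minus its own mean, so dropping the centering only increases the
     second moment. *)
  rewrite (_ : \int[gamma]_t (X t - Y t) ^+ 2 = \int[gamma]_t
      (dot v (t.1 - t.2) - \int[gamma]_s dot v (s.1 - s.2)) ^+ 2); last first.
    apply: eq_Rintegral => t _; rewrite /X /Y.
    rewrite -(Rintegral_fst ci) -(Rintegral_snd cj).
    under [in RHS]eq_Rintegral do rewrite dotBr.
    rewrite RintegralB//; first by rewrite dotBr; ring.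
      exact: (integrable_fst ci).
    exact: (integrable_snd cj).
  apply: le_trans (Rintegral_sqr_centered iG iG2) _.
  apply: (@le_trans _ _ (norm2 v ^+ 2 * \int[gamma]_t norm2 (t.1 - t.2) ^+ 2)).
    rewrite -RintegralZl//; apply: le_Rintegral => //; first exact: integrable_funZ.
    move=> t _; rewrite -exprMn -[leLHS]real_normK ?num_real//.
    by rewrite ler_sqr ?nnegrE ?mulr_ge0 ?norm2_ge0// dot_abs_le.
  by rewrite exprMn mulrC ler_wpM2r// sqr_ge0.
have h1 := minkowski_sqr cv mX mY iX iY XY.
have h2 : Num.sqrt (\int[gamma]_t Y t ^+ 2) <=
    Num.sqrt (\int[gamma]_t X t ^+ 2) + c * norm2 v.
  apply: minkowski_sqr => //.
  by under eq_Rintegral do rewrite -sqrrN opprB.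
by rewrite ler_distl lerBlDr h2.
Qed.

End Coupling.

(** * From Wasserstein bounds to the theorem *)

(** The slack [a < b] produces a coupling from the infimum. Its cost is finite, hence integrability
    of the gap comes for free. *)
Lemma wasserstein_coupling (R : realType) (d n : nat)
    (xi pi : probability 'cV[R]_d R) (a b : R) : (0 < n)%N -> a < b ->
  (wasserstein n%:R xi pi <= a%:E)%E ->
  exists gamma, [/\ coupling xi pi gamma,
    integrable_fun gamma (fun t => norm2 (t.1 - t.2) ^+ n) &
    \int[gamma]_t norm2 (t.1 - t.2) ^+ n <= b ^+ n].
Proof.
move=> n0 ab Wa.
have /ereal_inf_lt[_ [gamma /= xipi <-]] : (wasserstein n%:R xi pi < b%:E)%E.
  by apply: le_lt_trans Wa _; rewrite lte_fin.
set I := (X in poweR X _) => Ib.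
have I0 : (0 <= I)%E by apply: integral_ge0 => t _; rewrite lee_fin powR_ge0.
have nR : (n%:R : R) != 0 by rewrite pnatr_eq0 -lt0n.
have b0 : 0 <= b by rewrite -lee_fin (le_trans (poweR_ge0 I n%:R^-1))// ltW.
have Ile : (I <= (b ^+ n)%:E)%E.
  (* Undo the root by raising both sides to the power [n]. *)
  have -> : I = poweR (poweR I n%:R^-1) n%:R by rewrite -poweRrM mulVf// poweRe1.
  have -> : (b ^+ n)%:E = poweR b%:E n%:R by rewrite poweR_EFin powR_mulrn.
  apply: (gt0_ler_poweR (ler0n R n)); last exact: ltW.
    by rewrite in_itv/= leey andbT poweR_ge0.
  by rewrite in_itv/= leey andbT lee_fin.
have E : I = (\int[gamma]_t (norm2 (t.1 - t.2) ^+ n)%:E)%E.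
  by apply: eq_integral => t _; rewrite powR_mulrn ?norm2_ge0.
have Ifin : I \is a fin_num.
  by rewrite ge0_fin_numE// (le_lt_trans Ile)// ltey.
exists gamma; split=> //.
- apply/integrableP; split.
    apply/measurable_EFinP; apply: measurable_funX.
    exact: measurable_norm2 (@measurable_gap R d).
  rewrite (_ : integral _ _ _ = I); first by rewrite (le_lt_trans Ile)// ltey.
  rewrite E; apply: eq_integral => t _ /=.
  by rewrite ger0_norm ?exprn_ge0 ?norm2_ge0.
- by rewrite /Rintegral -E -lee_fin fineK.
Qed.

(** In [(x - y) * (x + y)], the sum is twice the smaller term plus the distance, at most
    [2 * (s * k) + eps * k]; this is why the minimum of [a] and [b] suffices. *)
Lemma quad_form_gap (R : realFieldType) (x y a b k eps : R) :
  0 <= x -> 0 <= y -> 0 <= eps -> 0 <= k -> `|x - y| <= eps * k ->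
  x ^+ 2 <= a * k ^+ 2 -> y ^+ 2 <= b * k ^+ 2 ->
  forall s, 0 <= s -> s ^+ 2 = Num.min a b ->
  `|x ^+ 2 - y ^+ 2| <= (2 * eps * s + eps ^+ 2) * k ^+ 2.
Proof.
move=> x0 y0 e0 k0 /ler_normlP[yx xy] xa yb s s0 sE.
have sk : Num.min x y <= s * k.
  rewrite -(@ler_sqr R) ?nnegrE ?mulr_ge0 ?le_min ?x0//.
  rewrite exprMn sE; have [ab|ba] := leP a b.
    by apply: le_trans xa; rewrite ler_sqr ?nnegrE ?le_min ?x0// ge_min lexx.
  by apply: le_trans yb; rewrite ler_sqr ?nnegrE ?le_min ?x0// ge_min lexx orbT.
have ek : 0 <= eps * k by rewrite mulr_ge0.
have -> : (2 * eps * s + eps ^+ 2) * k ^+ 2 =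
  eps * k * (2 * (s * k) + eps * k) by ring.
rewrite subr_sqr normrM; apply: ler_pM => //.
  by rewrite ler_norml; apply/andP; split; lra.
rewrite ger0_norm ?addr_ge0//.
by move: sk; rewrite /Num.min; case: ifP => _ ?; lra.
Qed.

Theorem theorem3p4 (R : realType) (d : nat) (pihat pi : probability 'cV[R]_d R)
    (eps : R) (eps_gt0 : 0 < eps) :
  (finite_moment 1 pihat -> finite_moment 1 pi ->
   (wasserstein 1 pihat pi <= eps%:E)%E \/
     (wasserstein 2 pihat pi <= eps%:E)%E ->
   norm2 (mean pihat - mean pi) <= eps /\
   \big[Num.max/0]_(i < d) `|mad pihat i - mad pi i| <= 2 * eps) /\
  (finite_moment 2 pihat -> finite_moment 2 pi ->
   (wasserstein 2 pihat pi <= eps%:E)%E ->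
   let S := Num.sqrt (Num.min (spectral_norm (cov_mx pihat))
                              (spectral_norm (cov_mx pi))) in
   \big[Num.max/0]_(i < d) `|std_dev pihat i - std_dev pi i| <= eps /\
   spectral_norm (cov_mx pihat - cov_mx pi) < 2 * eps * (S + eps)).
Proof.
split=> [mhat mpi W|mhat mpi W S].
  (* Either hypothesis yields couplings of first-order cost arbitrarily close to [eps]. *)
  have approx e : 0 < e -> exists gamma, [/\ coupling pihat pi gamma,
      integrable_fun gamma (fun t => norm2 (t.1 - t.2)) &
      \int[gamma]_t norm2 (t.1 - t.2) <= eps + e].
    move=> e0; have ee : eps < eps + e by rewrite ltrDl.
    case: W => [/(@wasserstein_coupling _ _ 1 _ _ _ _ isT ee)|
                /(@wasserstein_coupling _ _ 2 _ _ _ _ isT ee)].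
      by [].
    move=> [gamma [c iD2 D2]]; exists gamma.
    have iD : integrable_fun gamma (fun t => norm2 (t.1 - t.2)).
      apply: integrable_of_sqr iD2.
      exact: measurable_norm2 (@measurable_gap R d).
    by split=> //; apply: Rintegral_le_of_sqr => //; exact: addr_gt0.
  split.
    apply/ler_addgt0Pr => e /approx[gamma [c iD]]; apply/le_trans.
    exact: mean_coupling_le.
  (* The maximum starts from 0, so the bound itself must be nonnegative. *)
  apply: bigmax_le => [|i _]; first by rewrite mulr_ge0// ltW.
  apply/ler_addgt0Pr => e e0.
  (* Half of [e], since the MAD bound doubles the cost. *)
  have /approx[gamma [c iD D]] : 0 < e / 2 by rewrite divr_gt0.
  apply: le_trans (mad_coupling_le c i mhat mpi iD) _; lra.
have dir_std v :
    `|Num.sqrt (dir_var pihat v) - Num.sqrt (dir_var pi v)| <= eps * norm2 v.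
  apply/ler_addgt0Pr => e e0.
  have n1 : 0 < norm2 v + 1 by rewrite ltr_wpDl ?norm2_ge0.
  (* Chosen so that [e' * norm2 v <= e]; the added 1 keeps the denominator positive when [v] is
     zero. *)
  pose e' := e / (norm2 v + 1).
  have e'0 : 0 < e' by rewrite divr_gt0.
  have ee : eps < eps + e' by rewrite ltrDl.
  have [gamma [c iD D]] := @wasserstein_coupling _ _ 2 _ _ _ _ isT ee W.
  have ce : 0 < eps + e' by rewrite addr_gt0.
  apply: le_trans (dir_std_coupling_le c v ce mhat mpi iD D) _.
  rewrite mulrDl lerD2l /e' mulrAC ler_pdivrMr//.
  by rewrite ler_pM2l// lerDl.
split.
  apply: bigmax_le => [|i _]; first exact: ltW.
  by rewrite !std_devE// (le_trans (dir_std _))// norm2_delta mulr1.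
have S0 : 0 <= S by exact: sqrtr_ge0.
apply: (@le_lt_trans _ _ (2 * eps * S + eps ^+ 2)); last first.
  by rewrite mulrDr ltrD2l; have := exprn_gt0 2 eps_gt0; rewrite expr2; lra.
apply: spectral_norm_le => [||v].
- by rewrite linearB/= !cov_mx_sym.
- by rewrite addr_ge0 ?sqr_ge0// !mulr_ge0// ltW.
have sq xi : finite_moment 2 xi ->
    Num.sqrt (dir_var xi v) ^+ 2 <= spectral_norm (cov_mx xi) * norm2 v ^+ 2.
  by move=> mxi; rewrite sqr_sqrtr ?dir_var_ge0// -quad_cov// quad_le_spectral.
rewrite mulmxBl dotBr !quad_cov//.
(* Variances become squares of directional standard deviations, the form that [quad_form_gap]
   expects, with [k] equal to [norm2 v]. *)
rewrite -[dir_var pihat v]sqr_sqrtr ?dir_var_ge0//.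
rewrite -[dir_var pi v]sqr_sqrtr ?dir_var_ge0//.
apply: (quad_form_gap _ _ _ _ (dir_std v) (sq _ mhat) (sq _ mpi));
  rewrite ?sqrtr_ge0 ?norm2_ge0 ?(ltW eps_gt0)//.
by rewrite sqr_sqrtr// le_min !spectral_norm_ge0.
Qed.
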